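(* Let $\mathcal{F}$ be a finite subcollection of $\mathcal{M}(\mathbb{D})$. Then every composition sequence generated by $\mathcal{F}$ that is of limit-disc type is also of limit-tangent type.
   Context: $\mathbb{D}$ is the open unit disc in $\mathbb{C}$. A Möbius transformation is a map $z\mapsto (az+b)/(cz+d)$ with $a,b,c,d\in\mathbb{C}$, $ad-bc\neq 0$, acting on $\overline{\mathbb{C}}=\mathbb{C}\cup\{\infty\}$. $\mathcal{M}(\mathbb{D})$ denotes the set of Möbius transformations $f$ with $f(\mathbb{D})\subset\mathbb{D}$ and $f(\mathbb{D})\neq\mathbb{D}$. Given a collection $\mathcal{F}$ of maps, a composition sequence generated by $\mathcal{F}$ is a sequence $(F_n)$ with $F_n=f_1f_2\cdots f_n$ (composition), where each $f_i\in\mathcal{F}$. For such a sequence with $\mathcal{F}\subset\mathcal{M}(\mathbb{D})$, the discs $\mathbb{D}\supset F_1(\mathbb{D})\supset F_2(\mathbb{D})\supset\cdots$ are nested, and $\bigcap_n F_n(\overline{\mathbb{D}})$ is either a single point (the sequence is then of limit-point type) or a closed disc of positive radius (the sequence is then of limit-disc type). The sequence is of limit-tangent type if all but finitely many of the discs in $\mathbb{D}\supset F_1(\mathbb{D})\supset F_2(\mathbb{D})\supset\cdots$ share a single common boundary point. *)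

(* Defs.v *)
From Stdlib Require Import Reals List.
Open Scope R_scope.

Definition C : Type := (R * R)%type.
Definition Cre (z : C) : R := fst z.
Definition Cim (z : C) : R := snd z.
Definition Cadd (z w : C) : C := (Cre z + Cre w, Cim z + Cim w).
Definition Csub (z w : C) : C := (Cre z - Cre w, Cim z - Cim w).
Definition Cmul (z w : C) : C :=
  (Cre z * Cre w - Cim z * Cim w, Cre z * Cim w + Cim z * Cre w).
Definition Cnorm2 (z : C) : R := Cre z * Cre z + Cim z * Cim z.
Definition Cinv (z : C) : C := (Cre z / Cnorm2 z, - Cim z / Cnorm2 z).
Definition Cdiv (z w : C) : C := Cmul z (Cinv w).
Definition Cabs (z : C) : R := sqrt (Cnorm2 z).
Definition C0 : C := (0, 0).

Definition Mob : Type := (C * C * C * C)%type.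
Definition mob_a (m : Mob) : C := fst (fst (fst m)).
Definition mob_b (m : Mob) : C := snd (fst (fst m)).
Definition mob_c (m : Mob) : C := snd (fst m).
Definition mob_d (m : Mob) : C := snd m.
Definition mob_nondeg (m : Mob) : Prop :=
  Csub (Cmul (mob_a m) (mob_d m)) (Cmul (mob_b m) (mob_c m)) <> C0.
(* action on finite points (used only where c z + d <> 0) *)
Definition mob_app (m : Mob) (z : C) : C :=
  Cdiv (Cadd (Cmul (mob_a m) z) (mob_b m)) (Cadd (Cmul (mob_c m) z) (mob_d m)).

Definition inD (z : C) : Prop := Cabs z < 1.
Definition inDbar (z : C) : Prop := Cabs z <= 1.

(* f(D) is contained in D: every z in D is a finite point of f (c z + d <> 0,
   i.e. f z <> infinity) and f z lies in D. *)
Definition maps_D_into_D (m : Mob) : Prop :=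
  forall z, inD z -> Cadd (Cmul (mob_c m) z) (mob_d m) <> C0 /\ inD (mob_app m z).

Definition in_MD (m : Mob) : Prop :=
  mob_nondeg m /\ maps_D_into_D m /\
  exists w, inD w /\ ~ (exists z, inD z /\ mob_app m z = w).

(* Composition sequence: f : nat -> Mob, f 0 playing the role of f_1.
   Fcomp f n = f_1 f_2 ... f_n (Fcomp f 0 = identity). *)
Fixpoint Fcomp (f : nat -> Mob) (n : nat) (z : C) : C :=
  match n with
  | O => z
  | S k => Fcomp f k (mob_app (f k) z)
  end.

Definition img_D (f : nat -> Mob) (n : nat) (w : C) : Prop :=
  exists z, inD z /\ Fcomp f n z = w.
Definition img_Dbar (f : nat -> Mob) (n : nat) (w : C) : Prop :=
  exists z, inDbar z /\ Fcomp f n z = w.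

Definition limit_disc_type (f : nat -> Mob) : Prop :=
  exists (c : C) (r : R), 0 < r /\
    forall w, (forall n, (1 <= n)%nat -> img_Dbar f n w) <-> Cabs (Csub w c) <= r.

Definition boundary_pt (S : C -> Prop) (p : C) : Prop :=
  forall eps, 0 < eps ->
    (exists z, S z /\ Cabs (Csub z p) < eps) /\
    (exists z, ~ S z /\ Cabs (Csub z p) < eps).

Definition limit_tangent_type (f : nat -> Mob) : Prop :=
  exists (p : C) (N : nat), forall n, (N <= n)%nat -> boundary_pt (img_D f n) p.

(* Main.v *)
(** Every [g] in [F] maps the disc into, but not onto, itself, so the closure of [g(D)] meets
the unit circle in at most one point. Precomposing a map with [h] multiplies
the radius of the image disc by at most [s] when [h(D)] lies in the disc
[|z| <= s <= 1]. As [F] is finite, the products [g h] with [g, h] in [F] for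
which [g h (D)] stays off the unit circle share one [s < 1]; since the radii of
the [F_n(D)] do not tend to zero, such products [f_n f_(n+1)] occur only
finitely often. From then on [f_n f_(n+1)] touches the circle, which forces the
unique point [b_n] of the circle with [|f_n(b_n)| = 1] to satisfy
[b_n = f_(n+1)(b_(n+1))], so that [F_n(b_n)] is a constant boundary point. *)
Require Import Defs.
From Stdlib Require Import Reals List Lra Lia Classical.
From Coquelicot Require Import Rcomplements Complex.

(** * Moduli and inverses of complex numbers *)

Lemma Cabs_Cmod (z : C) : Cabs z = Cmod z.
Proof.
unfold Cabs, Cmod, Cnorm2, Cre, Cim; f_equal; ring.
Qed.

Lemma Cinv_Cinv (z : C) : Defs.Cinv z = Cinv z.
Proof.
unfold Defs.Cinv, Cinv, Cnorm2, Cre, Cim.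
replace (fst z ^ 2 + snd z ^ 2)
  with (fst z * fst z + snd z * snd z) by ring.
reflexivity.
Qed.

Lemma Cmod_lt_sqr (x y : C) : Cmod x ^ 2 < Cmod y ^ 2 <-> Cmod x < Cmod y.
Proof.
pose proof (Cmod_ge_0 x); pose proof (Cmod_ge_0 y); split; intro; nra.
Qed.

Lemma Cmod_le_sub (x y : C) : Cmod x - Cmod y <= Cmod (x + y)%C.
Proof.
pose proof (Cmod_triangle (x + y)%C (- y)%C) as H.
rewrite Cmod_opp in H.
replace (x + y + - y)%C with x in H by ring.
lra.
Qed.

(** * Matrices of Möbius maps and their image discs *)

Definition mdet (m : Mob) : C := (mob_a m * mob_d m - mob_b m * mob_c m)%C.
Definition den (m : Mob) (z : C) : C := (mob_c m * z + mob_d m)%C.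
Definition mapp (m : Mob) (z : C) : C :=
  ((mob_a m * z + mob_b m) / den m z)%C.
Definition mmul (m h : Mob) : Mob :=
  ((mob_a m * mob_a h + mob_b m * mob_c h)%C,
   (mob_a m * mob_b h + mob_b m * mob_d h)%C,
   (mob_c m * mob_a h + mob_d m * mob_c h)%C,
   (mob_c m * mob_b h + mob_d m * mob_d h)%C).
(** Positivity means [|c| < |d|]: the pole lies outside the closed unit disc, possibly at
    infinity. *)
Definition gap (m : Mob) : R := Cmod (mob_d m) ^ 2 - Cmod (mob_c m) ^ 2.
Definition bounded_disc (m : Mob) : Prop := mdet m <> RtoC 0 /\ 0 < gap m.

(* [m] maps the unit disc onto the disc of centre [ctr m] and radius [rad m];
   both formulas are only meaningful when [0 < gap m]. *)
Definition ctr (m : Mob) : C :=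
  ((mob_b m * Cconj (mob_d m) - mob_a m * Cconj (mob_c m)) / RtoC (gap m))%C.
Definition rad (m : Mob) : R := Cmod (mdet m) / gap m.
(** The largest modulus on the closed image disc. For an image inside the unit disc, the value 1
    means contact with the unit circle. *)
Definition reach (m : Mob) : R := Cmod (ctr m) + rad m.

Lemma mob_app_mapp (m : Mob) (z : C) : mob_app m z = mapp m z.
Proof.
unfold mob_app, Defs.Cdiv; rewrite Cinv_Cinv; reflexivity.
Qed.

Lemma gap_conj (m : Mob) :
  RtoC (gap m) =
  (mob_d m * Cconj (mob_d m) - mob_c m * Cconj (mob_c m))%C.
Proof.
unfold gap; rewrite RtoC_minus, !Cmod2_conj; reflexivity.
Qed.

Lemma gap_neq0 (m : Mob) : 0 < gap m -> RtoC (gap m) <> RtoC 0.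
Proof.
intros H E; apply RtoC_inj in E; lra.
Qed.

Lemma gap_Cmod (m : Mob) : 0 < gap m <-> Cmod (mob_c m) < Cmod (mob_d m).
Proof.
unfold gap; rewrite <- Cmod_lt_sqr; lra.
Qed.

Lemma den_neq0 (m : Mob) (z : C) :
  0 < gap m -> Cmod z <= 1 -> den m z <> RtoC 0.
Proof.
rewrite gap_Cmod; intros Hg Hz H0.
pose proof (Cmod_le_sub (mob_d m) (mob_c m * z)) as H.
replace (mob_d m + mob_c m * z)%C with (den m z) in H by (unfold den; ring).
rewrite H0, Cmod_0, Cmod_mult in H.
pose proof (Cmod_ge_0 (mob_c m)); nra.
Qed.

Lemma rad_gt0 (m : Mob) : bounded_disc m -> 0 < rad m.
Proof.
intros [Hd Hg]; apply Rdiv_lt_0_compat; auto; now apply Cmod_gt_0.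
Qed.

(** This is where the formulas for [ctr] and [rad] come from: when [|z| = 1] the numerator of the
    last quotient is [z] times the conjugate of [den m z], so the quotient has modulus 1. *)
Lemma mapp_sub_ctr (m : Mob) (z : C) :
  0 < gap m -> den m z <> RtoC 0 ->
  (mapp m z - ctr m =
   mdet m / RtoC (gap m) *
   ((Cconj (mob_d m) * z + Cconj (mob_c m)) / den m z))%C.
Proof.
intros Hg Hz; apply gap_neq0 in Hg.
unfold mapp, ctr, mdet; revert Hg Hz.
rewrite gap_conj; unfold den; intros Hg Hz.
field; auto.
Qed.

Lemma Cmod_rev_den (m : Mob) (z : C) :
  Cmod (Cconj (mob_d m) * z + Cconj (mob_c m))%C ^ 2 =
  Cmod (den m z) ^ 2 + gap m * (Cmod z ^ 2 - 1).
Proof.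
unfold gap, den; rewrite !Cmod2_alt.
destruct (mob_c m) as [c1 c2], (mob_d m) as [d1 d2], z as [x y].
unfold Re, Im; simpl; ring.
Qed.

Lemma dist_ctr (m : Mob) (z : C) :
  0 < gap m -> den m z <> RtoC 0 ->
  Cmod (mapp m z - ctr m)%C * Cmod (den m z) =
  rad m * Cmod (Cconj (mob_d m) * z + Cconj (mob_c m))%C.
Proof.
intros Hg Hz; rewrite mapp_sub_ctr by auto.
rewrite Cmod_mult, !Cmod_div, Cmod_R, Rabs_pos_eq
  by (first [lra | auto using gap_neq0]).
apply Cmod_gt_0 in Hz; unfold rad; field; lra.
Qed.

(** The factor [k] depends on [z], but only its sign matters: comparing [|z|] with 1 then decides
    whether the image is inside the disc or on its circle. *)
Lemma dist_ctr_sqr (m : Mob) (z : C) :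
  bounded_disc m -> Cmod z <= 1 ->
  exists k, 0 < k /\
  Cmod (mapp m z - ctr m)%C ^ 2 = rad m ^ 2 - k * (1 - Cmod z ^ 2).
Proof.
intros Hm Hz; pose proof (rad_gt0 m Hm) as Hr; destruct Hm as [Hd Hg].
pose proof (den_neq0 m z Hg Hz) as Hn.
pose proof (dist_ctr m z Hg Hn) as E.
pose proof (Cmod_rev_den m z) as E2.
apply Cmod_gt_0 in Hn.
exists (rad m ^ 2 * gap m / Cmod (den m z) ^ 2); split.
- apply Rdiv_lt_0_compat; [apply Rmult_lt_0_compat; auto|]; apply pow_lt; auto.
- apply (Rmult_eq_reg_r (Cmod (den m z) ^ 2)); [|nra].
  rewrite <- Rpow_mult_distr, E, Rpow_mult_distr, E2; field; lra.
Qed.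

Lemma mapp_closed_disc (m : Mob) (z : C) :
  bounded_disc m -> Cmod z <= 1 -> Cmod (mapp m z - ctr m)%C <= rad m.
Proof.
intros Hm Hz; pose proof (rad_gt0 m Hm) as Hr.
destruct (dist_ctr_sqr m z Hm Hz) as [k [Hk E]].
pose proof (Cmod_ge_0 z); pose proof (Cmod_ge_0 (mapp m z - ctr m)%C).
assert (0 <= k * (1 - Cmod z ^ 2)) by (apply Rmult_le_pos; nra).
nra.
Qed.

Lemma mapp_open_disc (m : Mob) (z : C) :
  bounded_disc m -> Cmod z < 1 -> Cmod (mapp m z - ctr m)%C < rad m.
Proof.
intros Hm Hz; pose proof (rad_gt0 m Hm) as Hr.
destruct (dist_ctr_sqr m z Hm) as [k [Hk E]]; [lra|].
pose proof (Cmod_ge_0 z); pose proof (Cmod_ge_0 (mapp m z - ctr m)%C).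
assert (0 < k * (1 - Cmod z ^ 2)) by (apply Rmult_lt_0_compat; nra).
nra.
Qed.

Lemma mapp_circle (m : Mob) (z : C) :
  bounded_disc m -> Cmod z = 1 -> Cmod (mapp m z - ctr m)%C = rad m.
Proof.
intros Hm Hz; pose proof (rad_gt0 m Hm) as Hr.
destruct (dist_ctr_sqr m z Hm) as [k [Hk E]]; [lra|].
rewrite Hz in E; pose proof (Cmod_ge_0 (mapp m z - ctr m)%C).
nra.
Qed.

Lemma mapp_closed_disc_onto (m : Mob) (w : C) :
  bounded_disc m -> Cmod (w - ctr m)%C <= rad m ->
  exists z : C, Cmod z <= 1 /\ mapp m z = w.
Proof.
intros [Hd Hg] Hw.
pose proof (gap_neq0 m Hg) as Hg0.
(* [u] is the value that the quotient in [mapp_sub_ctr] must take at a preimage of [w]. *)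
set (u := ((w - ctr m) * (RtoC (gap m) / mdet m))%C).
assert (Hu : Cmod u <= 1).
{ unfold u; rewrite Cmod_mult, Cmod_div, Cmod_R, Rabs_pos_eq by (auto; lra).
  unfold rad in Hw; apply Cmod_gt_0 in Hd.
  apply Rle_trans with (Cmod (mdet m) / gap m * (gap m / Cmod (mdet m))).
  - apply Rmult_le_compat_r; auto; apply Rlt_le, Rdiv_lt_0_compat; auto.
  - apply Req_le; field; lra. }
assert (Hn : (Cconj (mob_d m) - mob_c m * u)%C <> RtoC 0).
{ intro H0; apply gap_Cmod in Hg.
  pose proof (Cmod_le_sub (Cconj (mob_d m)) (- (mob_c m * u))%C) as H.
  unfold Cminus in H0; rewrite H0 in H.
  rewrite Cmod_0, Cmod_opp, Cmod_conj, Cmod_mult in H.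
  pose proof (Cmod_ge_0 (mob_c m)); nra. }
(* Solution of [(Cconj d * z + Cconj c) / (c * z + d) = u] for [z]. *)
set (z := ((mob_d m * u - Cconj (mob_c m)) / (Cconj (mob_d m) - mob_c m * u))%C).
assert (Hden : den m z = (RtoC (gap m) / (Cconj (mob_d m) - mob_c m * u))%C).
{ unfold den, z; rewrite gap_conj; field; auto. }
assert (Hrev : (Cconj (mob_d m) * z + Cconj (mob_c m))%C = (u * den m z)%C).
{ rewrite Hden; unfold z; rewrite gap_conj; field; auto. }
assert (Hden0 : den m z <> RtoC 0).
{ rewrite Hden; intro H0; apply Hg0.
  rewrite <- (Cmult_0_l (Cconj (mob_d m) - mob_c m * u)), <- H0; field; auto. }
exists z; split.
- pose proof (Cmod_rev_den m z) as E; rewrite Hrev, Cmod_mult in E.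
  pose proof (Cmod_ge_0 u); pose proof (Cmod_ge_0 (den m z)).
  assert (Cmod u * Cmod (den m z) <= 1 * Cmod (den m z))
    by (apply Rmult_le_compat_r; auto).
  assert (0 <= Cmod u * Cmod (den m z)) by (apply Rmult_le_pos; auto).
  apply Rnot_lt_le; intro.
  assert (0 < gap m * (Cmod z ^ 2 - 1)) by (apply Rmult_lt_0_compat; nra).
  nra.
- pose proof (mapp_sub_ctr m z Hg Hden0) as E; rewrite Hrev in E.
  replace (mapp m z) with (mapp m z - ctr m + ctr m)%C by ring.
  rewrite E; unfold u; field; auto.
Qed.

Lemma mapp_open_disc_onto (m : Mob) (w : C) :
  bounded_disc m -> Cmod (w - ctr m)%C < rad m ->
  exists z : C, Cmod z < 1 /\ mapp m z = w.
Proof.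
intros Hm Hw.
destruct (mapp_closed_disc_onto m w Hm) as [z [Hz E]]; [lra|].
exists z; split; auto.
destruct (Rle_lt_or_eq_dec _ _ Hz) as [|Hz1]; auto.
pose proof (mapp_circle m z Hm Hz1) as H; rewrite E in H; lra.
Qed.

(** * Injectivity, products, and the radius of a composite *)

Lemma mapp_inj (m : Mob) (x y : C) :
  mdet m <> RtoC 0 -> den m x <> RtoC 0 -> den m y <> RtoC 0 ->
  mapp m x = mapp m y -> x = y.
Proof.
intros Hd Hx Hy E.
assert (H : ((x - y) * mdet m)%C = RtoC 0).
{ replace ((x - y) * mdet m)%C
    with ((mapp m x - mapp m y) * (den m x * den m y))%C.
  - rewrite E; ring.
  - unfold mapp, mdet; revert Hx Hy; unfold den; intros; field; auto. }
apply Ceq_minus.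
destruct (Ceq_dec (x - y)%C 0) as [|Hn]; auto.
now elim (Cmult_neq_0 _ _ Hn Hd).
Qed.

Lemma mdet_mmul (m h : Mob) : mdet (mmul m h) = (mdet m * mdet h)%C.
Proof.
unfold mdet, mmul; cbn [mob_a mob_b mob_c mob_d fst snd]; ring.
Qed.

Lemma mapp_mmul (m h : Mob) (z : C) :
  bounded_disc m -> bounded_disc h -> Cmod z <= 1 -> Cmod (mapp h z) <= 1 ->
  mapp (mmul m h) z = mapp m (mapp h z).
Proof.
intros [_ Hm] [_ Hh] Hz Hhz.
pose proof (den_neq0 h z Hh Hz) as Hnh.
pose proof (den_neq0 m _ Hm Hhz) as Hnm.
assert (E : den (mmul m h) z = (den m (mapp h z) * den h z)%C).
{ unfold mmul, mapp, den in *; cbn [mob_a mob_b mob_c mob_d fst snd]; field; auto. }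
unfold mapp at 1 2; rewrite E; unfold mapp; revert Hnm.
set (q := den m _); intro.
unfold mmul; cbn [mob_a mob_b mob_c mob_d fst snd]; unfold den in *; field; auto.
Qed.

(** The map [w -> c w + d], with [c, d] from [m], sends the image disc of [h] to another disc. The
    bracket is the squared modulus of the centre of that disc minus its squared radius, hence
    positive when the disc avoids 0. *)
Lemma gap_mmul (m h : Mob) :
  0 < gap h ->
  gap (mmul m h) =
  gap h * (Cmod (mob_c m * ctr h + mob_d m)%C ^ 2
           - rad h ^ 2 * Cmod (mob_c m) ^ 2).
Proof.
intros Hh; pose proof (gap_neq0 h Hh) as Hh0.
assert (E : (mob_c m * ctr h + mob_d m)%C =
  ((mob_c m * (mob_b h * Cconj (mob_d h) - mob_a h * Cconj (mob_c h))
    + mob_d m * RtoC (gap h)) / RtoC (gap h))%C)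
  by (unfold ctr; field; auto).
rewrite E, Cmod_div, Cmod_R, Rabs_pos_eq by (auto; lra).
unfold rad.
match goal with |- _ = _ * ((?X / _) ^ 2 - _) =>
  assert (P : X ^ 2 - Cmod (mdet h) ^ 2 * Cmod (mob_c m) ^ 2 =
              gap h * gap (mmul m h)) end.
{ unfold gap, mmul, mdet; cbn [mob_a mob_b mob_c mob_d fst snd]; rewrite !Cmod2_alt.
  destruct (mob_c m) as [c1 c2], (mob_d m) as [d1 d2], (mob_a h) as [x1 x2],
    (mob_b h) as [y1 y2], (mob_c h) as [z1 z2], (mob_d h) as [t1 t2].
  unfold Re, Im, RtoC; simpl; ring. }
apply (Rmult_eq_reg_l (gap h)); [|lra].
rewrite <- P; field; lra.
Qed.

(** The real inequality behind [rad_mmul]: [c, d] are the moduli of the lower row of [m], [k] and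
    [p] are the modulus of the centre and the radius of the disc of [h], and [q] is the modulus of
    [c * ctr h + d]. *)
Lemma radius_estimate (c d k p q s : R) :
  0 <= c < d -> 0 <= k -> 0 < p -> k + p <= s -> s <= 1 -> d - c * k <= q ->
  0 < q ^ 2 - p ^ 2 * c ^ 2 /\
  p * (d ^ 2 - c ^ 2) <= s * (q ^ 2 - p ^ 2 * c ^ 2).
Proof.
intros Hc Hk Hp Hs Hs1 Hq.
assert (H1 : 0 < d - c * (k + p)) by nra.
assert (H2 : 0 < d - c * (k - p)) by nra.
assert (H3 : (d - c * (k + p)) * (d - c * (k - p)) <= q ^ 2 - p ^ 2 * c ^ 2)
  by nra.
split; [nra|].
(* The worst case is [k = s - p]. There the right side exceeds the left by exactly
   [(s - p)(d - cs)^2 + p c^2 (1 - s^2)]. *)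
apply Rle_trans with (s * ((d - c * s) * (d - c * (s - 2 * p)))).
- assert (0 <= (s - p) * (d - c * s) ^ 2)
    by (apply Rmult_le_pos; [lra | apply pow2_ge_0]).
  assert (0 <= p * c ^ 2 * (1 - s ^ 2))
    by (apply Rmult_le_pos; [apply Rmult_le_pos |]; nra).
  nra.
- apply Rmult_le_compat_l; [lra|].
  apply Rle_trans with (2 := H3).
  assert (c * k <= c * (s - p)) by (apply Rmult_le_compat_l; lra).
  apply Rmult_le_compat; nra.
Qed.

(** Used with [s = 1] to show that products stay bounded and radii do not grow, and with [s < 1] as
    the contraction. *)
Lemma rad_mmul (m h : Mob) (s : R) :
  bounded_disc m -> bounded_disc h -> reach h <= s -> s <= 1 ->
  bounded_disc (mmul m h) /\ rad (mmul m h) <= s * rad m.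
Proof.
intros Hm Hh Hs Hs1; pose proof (rad_gt0 h Hh) as Hr.
unfold reach in Hs.
destruct Hm as [Hdm Hgm], Hh as [Hdh Hgh].
pose proof (gap_mmul m h Hgh) as E.
pose proof (Cmod_le_sub (mob_d m) (mob_c m * ctr h)) as Hq.
rewrite Cmod_mult, (Cplus_comm (mob_d m)) in Hq.
destruct (radius_estimate (Cmod (mob_c m)) (Cmod (mob_d m)) (Cmod (ctr h))
  (rad h) (Cmod (mob_c m * ctr h + mob_d m)%C) s) as [HQ HQs];
  auto using Cmod_ge_0.
{ split; [apply Cmod_ge_0 | now apply gap_Cmod]. }
fold (gap m) in HQs; revert E HQ HQs.
generalize (Cmod (mob_c m * ctr h + mob_d m)%C ^ 2
            - rad h ^ 2 * Cmod (mob_c m) ^ 2); intros Q E HQ HQs.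
assert (Hg : 0 < gap (mmul m h))
  by (rewrite E; apply Rmult_lt_0_compat; auto).
split; [split; auto|].
- rewrite mdet_mmul; now apply Cmult_neq_0.
- apply Cmod_gt_0 in Hdm.
  assert (Er : rad (mmul m h) = Cmod (mdet m) * rad h / Q).
  { unfold rad; rewrite mdet_mmul, Cmod_mult, E; field; lra. }
  rewrite Er; unfold rad at 2.
  apply (Rmult_le_reg_r (Q * gap m)); [apply Rmult_lt_0_compat; auto|].
  replace (Cmod (mdet m) * rad h / Q * (Q * gap m))
    with (Cmod (mdet m) * (rad h * gap m)) by (field; lra).
  replace (s * (Cmod (mdet m) / gap m) * (Q * gap m))
    with (Cmod (mdet m) * (s * Q)) by (field; lra).
  apply Rmult_le_compat_l; lra.
Qed.

Lemma mmul_assoc (m h g : Mob) : mmul m (mmul h g) = mmul (mmul m h) g.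
Proof.
unfold mmul; cbn [mob_a mob_b mob_c mob_d fst snd].
f_equal; [f_equal; [f_equal|]|]; ring.
Qed.

(** * Largest modulus on an image disc and contact with the unit circle *)

Lemma radial_direction (k : C) :
  exists e : C, Cmod e = 1 /\
  forall t, 0 <= t -> Cmod (k + RtoC t * e)%C = Cmod k + t.
Proof.
destruct (Ceq_dec k 0) as [->|Hk].
- exists (RtoC 1); split; [apply Cmod_1|]; intros t Ht.
  rewrite Cmult_1_r, Cplus_0_l, Cmod_R, Cmod_0, Rabs_pos_eq; lra.
- pose proof (proj1 (Cmod_gt_0 k) Hk) as Hk0.
  assert (Hk1 : RtoC (Cmod k) <> RtoC 0)
    by (intro E; apply RtoC_inj in E; lra).
  exists (k / RtoC (Cmod k))%C; split.
  + rewrite Cmod_div, Cmod_R, Rabs_pos_eq by (auto; lra); field; lra.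
  + intros t Ht.
    replace (k + RtoC t * (k / RtoC (Cmod k)))%C
      with (k * RtoC (1 + t / Cmod k))%C.
    * rewrite Cmod_mult, Cmod_R, Rabs_pos_eq; [field; lra|].
      assert (0 <= t / Cmod k) by (apply Rdiv_le_0_compat; auto); lra.
    * rewrite RtoC_plus, RtoC_div by lra; field; auto.
Qed.

Lemma reach_le1 (m : Mob) :
  bounded_disc m ->
  (forall z, Cmod z < 1 -> Cmod (mapp m z) <= 1) -> reach m <= 1.
Proof.
intros Hm H; pose proof (rad_gt0 m Hm) as Hr.
destruct (radial_direction (ctr m)) as [e [He Hk]].
unfold reach; apply Rnot_lt_le; intro Hlt.
pose proof (Cmod_ge_0 (ctr m)) as Hc.
(* The midpoint of [1 - |ctr m|] and [rad m] gives a point of the open image disc outside the unit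
   disc. The cut-off at 0 covers a centre so far out that the midpoint is negative; the centre
   itself then serves. *)
set (t := Rmax 0 ((1 - Cmod (ctr m) + rad m) / 2)).
assert (Ht : 0 <= t < rad m /\ 1 < Cmod (ctr m) + t).
{ unfold t; destruct (Rle_dec 0 ((1 - Cmod (ctr m) + rad m) / 2)).
  - rewrite Rmax_right; lra.
  - rewrite Rmax_left; lra. }
destruct (mapp_open_disc_onto m (ctr m + RtoC t * e)%C Hm) as [z [Hz E]].
- replace (ctr m + RtoC t * e - ctr m)%C with (RtoC t * e)%C by ring.
  rewrite Cmod_mult, He, Cmod_R, Rabs_pos_eq; lra.
- specialize (H z Hz); rewrite E, Hk in H; lra.
Qed.

Lemma mapp_le_reach (m : Mob) (z : C) :
  bounded_disc m -> Cmod z <= 1 -> Cmod (mapp m z) <= reach m.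
Proof.
intros Hm Hz; pose proof (mapp_closed_disc m z Hm Hz) as H.
pose proof (Cmod_triangle (ctr m) (mapp m z - ctr m)) as H2.
replace (ctr m + (mapp m z - ctr m))%C with (mapp m z) in H2 by ring.
unfold reach; lra.
Qed.

Lemma mapp_lt_reach (m : Mob) (z : C) :
  bounded_disc m -> Cmod z < 1 -> Cmod (mapp m z) < reach m.
Proof.
intros Hm Hz; pose proof (mapp_open_disc m z Hm Hz) as H.
pose proof (Cmod_triangle (ctr m) (mapp m z - ctr m)) as H2.
replace (ctr m + (mapp m z - ctr m))%C with (mapp m z) in H2 by ring.
unfold reach; lra.
Qed.

Lemma reach_attained (m : Mob) :
  bounded_disc m -> exists z : C, Cmod z <= 1 /\ Cmod (mapp m z) = reach m.
Proof.
intros Hm; pose proof (rad_gt0 m Hm) as Hr.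
destruct (radial_direction (ctr m)) as [e [He Hk]].
destruct (mapp_closed_disc_onto m (ctr m + RtoC (rad m) * e)%C Hm)
  as [z [Hz E]].
- replace (ctr m + RtoC (rad m) * e - ctr m)%C
    with (RtoC (rad m) * e)%C by ring.
  rewrite Cmod_mult, He, Cmod_R, Rabs_pos_eq; lra.
- exists z; split; auto; rewrite E; apply Hk; lra.
Qed.

(* If [k <> 0], the only point of the closed disc of centre [k] and radius
   [1 - |k|] on the unit circle is [k / |k|]. *)
Lemma tangency_point (k w : C) (p : R) :
  Cmod (w - k)%C <= p -> Cmod w = 1 -> Cmod k + p <= 1 ->
  (RtoC (Cmod k) * w)%C = k.
Proof.
intros H Hw Hp.
assert (H0 : Cmod (RtoC (Cmod k) * w - k)%C ^ 2 <= 0).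
{ pose proof (Cmod_ge_0 k); pose proof (Cmod_ge_0 (w - k)%C).
  assert (Hs : Cmod (w - k)%C ^ 2 <= (1 - Cmod k) ^ 2) by nra.
  (* Since [|w| = 1], both sides expand to [2|k|^2 - 2|k| Re(w * Cconj k)]. *)
  replace (Cmod (RtoC (Cmod k) * w - k)%C ^ 2)
    with (Cmod k * (Cmod (w - k)%C ^ 2 - (1 - Cmod k) ^ 2)).
  - nra.
  - assert (Ew : Cmod w ^ 2 = 1) by (rewrite Hw; ring).
    pose proof (Cmod2_alt k) as Ek.
    rewrite Cmod2_alt in Ew |- *; rewrite Cmod2_alt.
    revert Ew Ek; generalize (Cmod k) as c; intro c.
    destruct w as [x y], k as [u v]; unfold Re, Im; simpl; intros Ew Ek.
    assert (Ex : x * x = 1 - y * y) by lra.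
    assert (Eu : u * u = c * c - v * v) by lra.
    ring [Ex Eu]. }
apply Ceq_minus, Cmod_eq_0.
pose proof (Cmod_ge_0 (RtoC (Cmod k) * w - k)%C); nra.
Qed.

(** Both images are the tangency point [ctr m / |ctr m|], and [mapp m] is injective on the closed
    disc. The bound [rad m < 1] keeps the centre away from 0. *)
Lemma unit_image_unique (m : Mob) (x y : C) :
  bounded_disc m -> reach m <= 1 -> rad m < 1 ->
  Cmod x <= 1 -> Cmod y <= 1 ->
  Cmod (mapp m x) = 1 -> Cmod (mapp m y) = 1 -> x = y.
Proof.
intros Hm Hs Hr Hx Hy Ex Ey; unfold reach in Hs.
pose proof (mapp_closed_disc m x Hm Hx) as Dx.
pose proof (mapp_closed_disc m y Hm Hy) as Dy.
pose proof (tangency_point _ _ _ Dx Ex Hs) as Tx.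
pose proof (tangency_point _ _ _ Dy Ey Hs) as Ty.
pose proof (mapp_le_reach m x Hm Hx) as Hle; unfold reach in Hle.
assert (Hk : RtoC (Cmod (ctr m)) <> RtoC 0)
  by (intro E; apply RtoC_inj in E; lra).
destruct Hm as [Hd Hg].
apply (mapp_inj m); auto using den_neq0.
replace (mapp m x)
  with (RtoC (Cmod (ctr m)) * mapp m x / RtoC (Cmod (ctr m)))%C
  by (field; auto).
rewrite Tx, <- Ty at 1; field; auto.
Qed.

(** * Geometry of self-maps of the disc that are not onto *)

Lemma in_MD_gap (m : Mob) :
  mdet m <> RtoC 0 ->
  (forall z : C, Cmod z < 1 -> den m z <> RtoC 0 /\ Cmod (mapp m z) < 1) ->
  0 < gap m.
Proof.
(* If [|d| <= |c|], the pole lies in the closed disc. Near it the denominator is small but the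
   numerator is not, which contradicts [|m(z)| < 1]. *)
intros Hd H; apply gap_Cmod, Rnot_le_lt; intro Hle.
pose proof (proj1 (Cmod_gt_0 _) Hd) as Hd0.
pose proof (Cmod_ge_0 (mob_a m)); pose proof (Cmod_ge_0 (mob_d m)).
assert (Hc : mob_c m <> RtoC 0).
{ intro E; rewrite E, Cmod_0 in Hle.
  assert (Ed : mob_d m = RtoC 0) by (apply Cmod_eq_0; lra).
  apply Hd; unfold mdet; rewrite E, Ed; ring. }
pose proof (proj1 (Cmod_gt_0 _) Hc) as Hc0.
set (K := Cmod (mob_a m) * Cmod (mob_d m) + Cmod (mob_c m) * Cmod (mob_d m)).
assert (HK : 0 <= K) by (unfold K; nra).
(* Chosen so that [e K = (1 - e) |mdet m|], strictly below [|mdet m|]. The test point [z] is the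
   pole scaled by [1 - e]. *)
set (e := Cmod (mdet m) / (Cmod (mdet m) + K)).
assert (He : e * (Cmod (mdet m) + K) = Cmod (mdet m))
  by (unfold e; field; lra).
assert (He0 : 0 < e <= 1).
{ split; [apply Rdiv_lt_0_compat; lra|].
  apply (Rmult_le_reg_r (Cmod (mdet m) + K)); lra. }
set (z := (- (RtoC (1 - e) * (mob_d m / mob_c m)))%C).
assert (Hz : Cmod z < 1).
{ unfold z; rewrite Cmod_opp, Cmod_mult, Cmod_R, Cmod_div, Rabs_pos_eq
    by (auto; lra).
  assert (Cmod (mob_d m) / Cmod (mob_c m) <= 1)
    by (apply Rle_div_l; lra).
  assert (0 <= Cmod (mob_d m) / Cmod (mob_c m))
    by (apply Rdiv_le_0_compat; lra).
  nra. }
destruct (H z Hz) as [Hn Hlt].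
assert (En : den m z = (RtoC e * mob_d m)%C).
{ unfold den, z; rewrite RtoC_minus; field; auto. }
unfold mapp in Hlt; rewrite Cmod_div in Hlt by auto.
apply Rlt_div_l in Hlt; [|now apply Rlt_gt, Cmod_gt_0].
rewrite En, Cmod_mult, Cmod_R, Rabs_pos_eq in Hlt by lra.
(* An instance of [mdet m + c (a z + b) = a (c z + d)]: a small numerator and a small denominator
   would make the determinant small. *)
assert (Ez : (mdet m + mob_c m * (mob_a m * z + mob_b m))%C =
             (RtoC e * (mob_a m * mob_d m))%C).
{ unfold mdet, z; rewrite RtoC_minus; field; auto. }
pose proof (Cmod_le_sub (mdet m) (mob_c m * (mob_a m * z + mob_b m))) as Hs.
rewrite Ez, !Cmod_mult, Cmod_R, Rabs_pos_eq in Hs by lra.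
assert (Cmod (mob_c m) * Cmod (mob_a m * z + mob_b m)%C <=
        Cmod (mob_c m) * (1 * (e * Cmod (mob_d m))))
  by (apply Rmult_le_compat_l; lra).
assert (Cmod (mdet m) <= e * K) by (unfold K; lra).
assert (0 < e * Cmod (mdet m)) by (apply Rmult_lt_0_compat; lra).
lra.
Qed.

Lemma in_MD_disc (m : Mob) :
  in_MD m -> bounded_disc m /\ reach m <= 1 /\ rad m < 1.
Proof.
intros [Hd [Hmap [w [Hw Hnot]]]].
assert (H : forall z : C, Cmod z < 1 ->
            den m z <> RtoC 0 /\ Cmod (mapp m z) < 1).
{ intros z Hz; rewrite <- mob_app_mapp, <- Cabs_Cmod.
  apply Hmap; unfold inD; now rewrite Cabs_Cmod. }
assert (Hm : bounded_disc m) by (split; [exact Hd | now apply in_MD_gap]).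
assert (Hs : reach m <= 1)
  by (apply reach_le1; auto; intros z Hz; apply Rlt_le, H, Hz).
repeat split; try apply Hm; auto.
(* A radius of at least 1 forces centre 0, so the image covers the unit disc, including the omitted
   point [w]. *)
apply Rnot_le_lt; intro Hr.
unfold reach in Hs; pose proof (Cmod_ge_0 (ctr m)).
assert (Ec : ctr m = RtoC 0) by (apply Cmod_eq_0; lra).
unfold inD in Hw; rewrite Cabs_Cmod in Hw.
destruct (mapp_open_disc_onto m w Hm) as [z [Hz E]].
{ rewrite Ec; unfold Cminus; rewrite Copp_0, Cplus_0_r; lra. }
apply Hnot; exists z; split; [unfold inD; now rewrite Cabs_Cmod|].
now rewrite mob_app_mapp.
Qed.

(** * Finiteness and geometric decay *)

Lemma finite_gap_below_1 (l : list R) :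
  exists s, 0 <= s < 1 /\ forall x, In x l -> x < 1 -> x <= s.
Proof.
induction l as [|a l [s [Hs IH]]].
- exists 0; split; [lra | intros x []].
- destruct (Rlt_dec a 1) as [Ha|Ha].
  + exists (Rmax a s); split.
    * split; [apply Rle_trans with s; [lra | apply Rmax_r]|].
      apply Rmax_lub_lt; lra.
    * intros x [<-|Hx] Hx1; [apply Rmax_l|].
      apply Rle_trans with s; [auto | apply Rmax_r].
  + exists s; split; auto; intros x [<-|Hx] Hx1; [contradiction | auto].
Qed.

(** Each failure multiplies [u] by at most [s] within two steps. Infinitely many failures would
    include infinitely many non-overlapping ones, pushing [u] below [r]. The lag of two matches a
    pair of consecutive maps. *)
Lemma finitely_many_contractions (u : nat -> R) (r s : R) :
  0 < r -> (forall n, r <= u n) -> (forall n, u (S n) <= u n) ->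
  0 <= s < 1 ->
  exists N, forall n, (N <= n)%nat -> s * u n < u (S (S n)).
Proof.
intros Hr Hu Hdec Hs; apply NNPP; intro Hno.
assert (Hmon : forall n k, (n <= k)%nat -> u k <= u n)
  by (induction 1; [lra | eapply Rle_trans; eauto]).
assert (Hk : forall k, exists n, u n <= s ^ k * u O).
{ induction k as [|k [n IH]]; [exists O; simpl; lra|].
  apply NNPP; intro Hk; apply Hno; exists n; intros i Hi.
  apply Rnot_le_lt; intro Hc; apply Hk; exists (S (S i)).
  simpl; rewrite Rmult_assoc; apply Rle_trans with (1 := Hc).
  apply Rmult_le_compat_l; [lra|].
  apply Rle_trans with (u n); auto. }
assert (H0 : 0 < u O) by (specialize (Hu O); lra).
destruct (pow_lt_1_zero s) with (y := r / u O) as [k Hsk].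
- rewrite Rabs_pos_eq; lra.
- apply Rdiv_lt_0_compat; auto.
- specialize (Hsk k (le_n k)); destruct (Hk k) as [n Hn].
  apply Rlt_div_r in Hsk; [|lra].
  pose proof (Rle_abs (s ^ k)); specialize (Hu n); nra.
Qed.

(** * Boundary points and the discs of a composition sequence *)

Lemma boundary_mapp (m : Mob) (y : C) (S : Defs.C -> Prop) :
  bounded_disc m -> Cmod y = 1 ->
  (forall w : C, S w <-> Cmod (w - ctr m)%C < rad m) ->
  boundary_pt S (mapp m y).
Proof.
intros Hm Hy HS eps Heps; pose proof (rad_gt0 m Hm) as Hr.
pose proof (mapp_circle m y Hm Hy) as Hc.
set (p := mapp m y) in *.
(* This choice gives both [t < 1] and [t * rad m < eps], so moving from [p] towards the centre by
   the fraction [t] lands inside the disc and near [p]. *)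
set (t := eps / (eps + rad m)).
assert (Et : t * (eps + rad m) = eps) by (unfold t; field; lra).
assert (Ht : 0 < t) by (apply Rdiv_lt_0_compat; lra).
split.
- exists (p - RtoC t * (p - ctr m))%C; split.
  + apply HS.
    replace (p - RtoC t * (p - ctr m) - ctr m)%C
      with (RtoC (1 - t) * (p - ctr m))%C by (rewrite RtoC_minus; ring).
    rewrite Cmod_mult, Hc, Cmod_R, Rabs_pos_eq; nra.
  + rewrite Cabs_Cmod.
    replace (Csub (p - RtoC t * (p - ctr m))%C p)
      with (- (RtoC t * (p - ctr m)))%C
      by (change Csub with Cminus; ring).
    rewrite Cmod_opp, Cmod_mult, Hc, Cmod_R, Rabs_pos_eq; nra.
- exists p; split; [rewrite HS; lra|].
  rewrite Cabs_Cmod; change Csub with Cminus.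
  replace (p - p)%C with (RtoC 0) by ring; rewrite Cmod_0; auto.
Qed.

Fixpoint Fmat (f : nat -> Mob) (n : nat) : Mob :=
  match n with
  | O => (RtoC 1, RtoC 0, RtoC 0, RtoC 1)
  | S k => mmul (Fmat f k) (f k)
  end.

Lemma Fmat_disc (f : nat -> Mob) (n : nat) :
  (forall k, bounded_disc (f k) /\ reach (f k) <= 1) ->
  bounded_disc (Fmat f n).
Proof.
intros Hf; induction n as [|n IH].
- split.
  + unfold mdet; cbn [Fmat mob_a mob_b mob_c mob_d fst snd].
    rewrite Cmult_0_l, Cmult_1_l; unfold Cminus.
    rewrite Copp_0, Cplus_0_r; exact C1_nz.
  + unfold gap; cbn [Fmat mob_c mob_d fst snd].
    rewrite Cmod_1, Cmod_0; lra.
- destruct (Hf n) as [Hd Hr].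
  exact (proj1 (rad_mmul _ _ 1 IH Hd Hr (Rle_refl 1))).
Qed.

Lemma Fcomp_mapp (f : nat -> Mob) (n : nat) (z : C) :
  (forall k, bounded_disc (f k) /\ reach (f k) <= 1) ->
  Cmod z <= 1 -> Fcomp f n z = mapp (Fmat f n) z.
Proof.
intros Hf; revert z; induction n as [|n IH]; intros z Hz.
- unfold mapp, den; cbn [Fmat Fcomp mob_a mob_b mob_c mob_d fst snd].
  apply (eq_sym (y := z)); field; exact C1_nz.
- destruct (Hf n) as [Hd Hr].
  assert (H : Cmod (mapp (f n) z) <= 1)
    by (eapply Rle_trans; [apply mapp_le_reach|]; auto).
  cbn [Fcomp Fmat]; rewrite mob_app_mapp, IH, mapp_mmul by
    auto using Fmat_disc; reflexivity.
Qed.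

Lemma img_D_disc (f : nat -> Mob) (n : nat) (w : C) :
  (forall k, bounded_disc (f k) /\ reach (f k) <= 1) ->
  img_D f n w <-> Cmod (w - ctr (Fmat f n))%C < rad (Fmat f n).
Proof.
intros Hf; pose proof (Fmat_disc f n Hf) as Hm; split.
- intros [z [Hz <-]]; unfold inD in Hz; rewrite Cabs_Cmod in Hz.
  rewrite Fcomp_mapp by (auto; lra); now apply mapp_open_disc.
- intros Hw; destruct (mapp_open_disc_onto _ _ Hm Hw) as [z [Hz E]].
  exists z; unfold inD; rewrite Cabs_Cmod, Fcomp_mapp by (auto; lra); auto.
Qed.

(** The points [c + r] and [c - r] of the limit disc, at distance [2 r], lie in every closed disc of
    the sequence. The index [S n] reflects that the intersection starts at 1. *)
Lemma limit_disc_rad (f : nat -> Mob) :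
  (forall k, bounded_disc (f k) /\ reach (f k) <= 1) ->
  limit_disc_type f -> exists r, 0 < r /\ forall n, r <= rad (Fmat f (S n)).
Proof.
intros Hf [c [r [Hr Hlim]]]; exists r; split; auto; intro n.
pose proof (Fmat_disc f (S n) Hf) as Hm.
assert (H : forall v : C, Cmod v <= r ->
            Cmod (c + v - ctr (Fmat f (S n)))%C <= rad (Fmat f (S n))).
{ intros v Hv.
  destruct (proj2 (Hlim (c + v)%C)) with (n := S n) as [z [Hz <-]].
  - rewrite Cabs_Cmod; change Csub with Cminus.
    replace (c + v - c)%C with v by ring; auto.
  - apply le_n_S, Nat.le_0_l.
  - unfold inDbar in Hz; rewrite Cabs_Cmod in Hz.
    rewrite Fcomp_mapp by auto; now apply mapp_closed_disc. }
pose proof (H (RtoC r)) as H1; pose proof (H (- RtoC r)%C) as H2.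
rewrite Cmod_opp in H2; rewrite Cmod_R, Rabs_pos_eq in H1, H2 by lra.
specialize (H1 (Rle_refl r)); specialize (H2 (Rle_refl r)).
pose proof (Cmod_triangle (c + RtoC r - ctr (Fmat f (S n)))
              (- (c + - RtoC r - ctr (Fmat f (S n))))) as Ht.
rewrite Cmod_opp in Ht.
replace (c + RtoC r - ctr (Fmat f (S n)) +
         - (c + - RtoC r - ctr (Fmat f (S n))))%C
  with (RtoC (2 * r)) in Ht by (rewrite RtoC_mult; ring).
rewrite Cmod_R, Rabs_pos_eq in Ht; lra.
Qed.

(** * Consecutive pairs touching the circle and the common boundary point *)

Lemma mmul_disc (g h : Mob) :
  bounded_disc g -> reach g <= 1 -> bounded_disc h -> reach h <= 1 ->
  bounded_disc (mmul g h) /\ reach (mmul g h) <= 1.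
Proof.
intros Hg Rg Hh Rh.
assert (Hgh : bounded_disc (mmul g h))
  by exact (proj1 (rad_mmul g h 1 Hg Hh Rh (Rle_refl 1))).
split; auto; apply reach_le1; auto; intros z Hz.
assert (Hhz : Cmod (mapp h z) <= 1)
  by (eapply Rle_trans; [apply mapp_le_reach|]; auto; lra).
rewrite mapp_mmul by (auto; lra).
eapply Rle_trans; [apply mapp_le_reach|]; auto.
Qed.

Lemma eventually_tangent_pairs (F : list Mob) (f : nat -> Mob) :
  (forall g, In g F -> in_MD g) -> (forall n, In (f n) F) ->
  limit_disc_type f ->
  exists N, forall n, (N <= n)%nat -> reach (mmul (f n) (f (S n))) = 1.
Proof.
intros HF Hf Hlim.
assert (Hd : forall k, bounded_disc (f k) /\ reach (f k) <= 1)
  by (intro k; destruct (in_MD_disc (f k)) as [? [? ?]]; auto).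
destruct (limit_disc_rad f Hd Hlim) as [r [Hr Hrad]].
(* One [s] serves all products of two members of [F], because there are finitely many. *)
destruct (finite_gap_below_1
  (map (fun p => reach (mmul (fst p) (snd p))) (list_prod F F)))
  as [s [Hs Hgap]].
destruct (finitely_many_contractions (fun n => rad (Fmat f (S n))) r s)
  as [N HN]; auto.
{ intro n; destruct (Hd (S n)) as [H1 H2].
  destruct (rad_mmul (Fmat f (S n)) (f (S n)) 1) as [_ H];
    auto using Fmat_disc; try lra.
  change (Fmat f (S (S n))) with (mmul (Fmat f (S n)) (f (S n))); lra. }
(* The sequence of radii begins at [Fmat f 1], so its step from [n] to [n + 2] composes with
   [f (S n)] and [f (S (S n))]; hence the shift by one. *)
exists (S N); intros [|n] Hn; [lia|]; apply le_S_n in Hn.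
destruct (mmul_disc (f (S n)) (f (S (S n)))) as [Hp Hp1];
  try apply Hd.
apply Rle_antisym; auto; apply Rnot_lt_le; intro Hlt.
assert (Hle : reach (mmul (f (S n)) (f (S (S n)))) <= s).
{ apply Hgap; auto.
  exact (in_map (fun p => reach (mmul (fst p) (snd p))) _ _
           (in_prod _ _ _ _ (Hf (S n)) (Hf (S (S n))))). }
destruct (rad_mmul (Fmat f (S n)) _ s (Fmat_disc f (S n) Hd) Hp Hle)
  as [_ H]; [lra|].
rewrite mmul_assoc in H; specialize (HN n Hn); cbn beta in HN.
change (Fmat f (S (S (S n))))
  with (mmul (mmul (Fmat f (S n)) (f (S n))) (f (S (S n)))) in HN; lra.
Qed.

Theorem theorem1p1 :
  forall (F : list Mob),
    (forall g, In g F -> in_MD g) ->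
    forall (f : nat -> Mob),
      (forall n, In (f n) F) ->
      limit_disc_type f ->
      limit_tangent_type f.
Proof.
intros F HF f Hf Hlim.
destruct (eventually_tangent_pairs F f HF Hf Hlim) as [N HN].
assert (Hd : forall k, bounded_disc (f k) /\ reach (f k) <= 1)
  by (intro k; destruct (in_MD_disc (f k)) as [? [? ?]]; auto).
assert (Hcl : forall k z, Cmod z <= 1 -> Cmod (mapp (f k) z) <= 1).
{ intros k z Hz; destruct (Hd k).
  eapply Rle_trans; [apply mapp_le_reach|]; auto. }
assert (Hcirc : forall k z, Cmod z <= 1 -> Cmod (mapp (f k) z) = 1 ->
                Cmod z = 1).
{ intros k z Hz E; apply Rle_antisym; auto; apply Rnot_lt_le; intro Hlt.
  destruct (Hd k) as [H1 H2]; pose proof (mapp_lt_reach (f k) z H1 Hlt); lra. }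
(* Reach 1 of the product is attained at some [z] in the closed disc. Interior points have images of
   modulus below 1, so [z] and its image under [f (S n)] lie on the circle. *)
assert (Hpair : forall n, (N <= n)%nat -> exists z : C,
  Cmod z = 1 /\ Cmod (mapp (f (S n)) z) = 1 /\
  Cmod (mapp (f n) (mapp (f (S n)) z)) = 1).
{ intros n Hn.
  destruct (mmul_disc (f n) (f (S n))) as [Hp _]; try apply Hd.
  destruct (reach_attained _ Hp) as [z [Hz E]].
  rewrite HN, mapp_mmul in E by (auto; apply Hd).
  pose proof (Hcirc n _ (Hcl (S n) z Hz) E).
  exists z; eauto. }
assert (Happ : forall n z, Cmod z <= 1 ->
  mapp (Fmat f (S n)) z = mapp (Fmat f n) (mapp (f n) z)).
{ intros n z Hz; apply mapp_mmul; auto using Fmat_disc; apply Hd. }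
destruct (Hpair N (le_n N)) as [z0 [Hz0 [Hy0 Ty0]]].
(* [Fmat f (S N)] ends with [f N], and is applied here to the circle point that [f N] sends to the
   circle. *)
exists (mapp (Fmat f (S N)) (mapp (f (S N)) z0)), (S N).
(* The point of the circle that [f n] sends to the circle is the image under
   [f (S n)] of the point that [f (S n)] sends to the circle. *)
assert (Hpt : forall n, (N <= n)%nat -> exists y : C,
  Cmod y = 1 /\ Cmod (mapp (f n) y) = 1 /\
  mapp (Fmat f (S n)) y = mapp (Fmat f (S N)) (mapp (f (S N)) z0)).
{ induction 1 as [|n Hn [y [Hy [Ty Ey]]]]; [eauto|].
  destruct (Hpair n Hn) as [z [Hz [Tz Tz2]]].
  exists z; repeat split; auto; rewrite Happ, <- Ey by lra.
  f_equal; destruct (in_MD_disc (f n)) as [H1 [H2 H3]]; auto.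
  apply (unit_image_unique (f n)); auto; lra. }
intros [|n] Hn; [lia|]; apply le_S_n in Hn.
destruct (Hpt n Hn) as [y [Hy [_ <-]]].
apply boundary_mapp; auto using Fmat_disc.
intro w; now apply img_D_disc.
Qed.
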